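(* Let $A$ and $B$ be two $C^*$-algebras and let $\Phi$ be an involutory $*$-antiautomorphism of $A$. Suppose that $\varphi: A_\Phi\longrightarrow \mathcal{M}(B)$ is a completely positive real-linear map, and let $\varphi^C: A\longrightarrow\mathcal{M}(B)$ be its complexification. Then $\varphi$ is weakly nuclear if and only if $\varphi^C$ is weakly nuclear.
   Context: All $C^*$-algebras are complex unless stated otherwise. An involutory $*$-antiautomorphism $\Phi$ of a $C^*$-algebra $A$ is a complex-linear $*$-preserving bijection with $\Phi(ab)=\Phi(b)\Phi(a)$ and $\Phi\circ\Phi=\mathrm{id}$. Put $A_\Phi=\{a\in A:\Phi(a)=a^*\}$; this is a real $*$-subalgebra of $A$ with $A_\Phi\cap iA_\Phi=\{0\}$ and $A=A_\Phi+iA_\Phi$ (called a real $C^*$-algebra, with complexification $A$). The complexification of a real-linear map $\varphi$ on $A_\Phi$ into a complex $C^*$-algebra is its unique complex-linear extension to $A$, $\varphi^C(a+ib)=\varphi(a)+i\varphi(b)$ for $a,b\in A_\Phi$. $\mathcal{M}(B)$ is the multiplier algebra of $B$. A real-linear map is completely positive (c.p.) if all its entrywise matrix amplifications map positive elements to positive elements. Nuclear maps: a c.p. map $\theta:A\to B$ between complex $C^*$-algebras is nuclear if it is a point-norm limit of maps $\psi\circ\phi$ with $\phi:A\to M_n(\mathbb{C})$ and $\psi:M_n(\mathbb{C})\to B$ c.p. (complex-linear). A c.p. real-linear map $\theta:A_\Phi\to B$ is nuclear if it is a point-norm limit of maps $\psi\circ\phi$ with $\phi:A_\Phi\to M_n(\mathbb{R})$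 and $\psi:M_n(\mathbb{R})\to B$ c.p. real-linear maps. Weakly nuclear maps: a c.p. map $\varphi:A\to\mathcal{M}(B)$ (respectively $\varphi:A_\Phi\to\mathcal{M}(B)$) is weakly nuclear if $b^*\varphi(\cdot)b:A\to B$ (respectively $b^*\varphi(\cdot)b:A_\Phi\to B$) is nuclear for every $b\in B$. *)

(* Defs.v *)
From HB Require Import structures.
From mathcomp Require Import all_boot all_order all_algebra.
From mathcomp Require Import complex.
From mathcomp Require Import all_classical all_reals all_analysis.

Set Implicit Arguments.
Unset Strict Implicit.
Unset Printing Implicit Defensive.

Import Order.TTheory GRing.Theory Num.Theory.
Import numFieldNormedType.Exports.

Local Open Scope classical_set_scope.
Local Open Scope ring_scope.
Local Open Scope complex_scope.

Reserved Notation "x ** y" (at level 40, left associativity).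

(* Not necessarily unital: MathComp's ring structures all have a unit, whereas
   C*-algebras need not. *)
HB.mixin Record Zmodule_isStarRng V of GRing.Zmodule V := {
  smul : V -> V -> V;
  star : V -> V;
  smulA : associative smul;
  smulDl : left_distributive smul +%R;
  smulDr : right_distributive smul +%R;
  starD : {morph star : x y / x + y};
  starM : forall x y, star (smul x y) = smul (star y) (star x);
  starK : involutive star
}.

#[short(type="starRngType")]
HB.structure Definition StarRng :=
  { V of GRing.Zmodule V & Zmodule_isStarRng V }.

Notation "x ** y" := (smul x y) : ring_scope.

HB.mixin Record NormedModule_isCStarAlgebra (R : realType) A
    of CompleteNormedModule R[i] A & StarRng A := {
  scale_smull : forall (k : R[i]) (a b : A), (k *: a) ** b = k *: (a ** b);
  scale_smulr : forall (k : R[i]) (a b : A), a ** (k *: b) = k *: (a ** b);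
  starZ : forall (k : R[i]) (a : A), star (k *: a) = k^*%C *: star a;
  norm_smul : forall a b : A, `|a ** b| <= `|a| * `|b|;
  norm_star_smul : forall a : A, `|star a ** a| = `|a| ^+ 2
}.

#[short(type="cstarAlgType")]
HB.structure Definition CStarAlgebra (R : realType) :=
  { A of CompleteNormedModule R[i] A & StarRng A
       & NormedModule_isCStarAlgebra R A }.

Section StarRngTheory.
Variable S : starRngType.
Implicit Types x y : S.

Lemma smul0r x : 0 ** x = 0.
Proof. by apply: (addIr (0 ** x)); rewrite -smulDl !add0r. Qed.

Lemma smulr0 x : x ** 0 = 0.
Proof. by apply: (addIr (x ** 0)); rewrite -smulDr !add0r. Qed.

Lemma smulNr x y : (- x) ** y = - (x ** y).
Proof. by apply: (addIr (x ** y)); rewrite -smulDl !addNr smul0r. Qed.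

Lemma smulrN x y : x ** (- y) = - (x ** y).
Proof. by apply: (addIr (x ** y)); rewrite -smulDr !addNr smulr0. Qed.

Lemma star0 : star 0 = 0 :> S.
Proof. by apply: (addIr (star 0)); rewrite -starD !add0r. Qed.

Lemma starN x : star (- x) = - star x.
Proof. by apply: (addIr (star x)); rewrite -starD !addNr star0. Qed.

Lemma smul_suml (I : Type) (r : seq I) (F : I -> S) y :
  (\sum_(i <- r) F i) ** y = \sum_(i <- r) F i ** y.
Proof. by elim/big_ind2: _ => [|? ? ? ? <- <-|//]; rewrite (smul0r, smulDl). Qed.

Lemma smul_sumr (I : Type) (r : seq I) (F : I -> S) y :
  y ** (\sum_(i <- r) F i) = \sum_(i <- r) y ** F i.
Proof. by elim/big_ind2: _ => [|? ? ? ? <- <-|//]; rewrite (smulr0, smulDr). Qed.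

Lemma star_sum (I : Type) (r : seq I) (F : I -> S) :
  star (\sum_(i <- r) F i) = \sum_(i <- r) star (F i).
Proof. by elim/big_ind2: _ => [|? ? ? ? <- <-|//]; rewrite (star0, starD). Qed.

End StarRngTheory.

Section ScalarStarRng.
Variable R : realType.

(* The reals carry the trivial involution; R^o rather than R, since R is
   abstract and cannot be the key of a canonical instance. *)
HB.instance Definition _ := Zmodule_isStarRng.Build R^o
  (@mulrA R) (@mulrDl R) (@mulrDr R) (fun _ _ => erefl)
  (@mulrC R) (fun=> erefl).

Let conjcD : {morph (@conjc R) : x y / x + y}.
Proof. exact: raddfD. Qed.

Let conjcM (x y : R[i]) : (x * y)^*%C = y^*%C * x^*%C.
Proof. by rewrite rmorphM mulrC. Qed.

HB.instance Definition _ := Zmodule_isStarRng.Build R[i]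
  (@mulrA R[i]) (@mulrDl R[i]) (@mulrDr R[i]) conjcD conjcM (@conjcK R).

End ScalarStarRng.

Section MatrixStarRng.
Variables (S : starRngType) (n : nat).
Implicit Types X Y Z : 'M[S]_n.

Definition smulmx X Y : 'M[S]_n := \matrix_(i, j) \sum_k X i k ** Y k j.
Definition starmx X : 'M[S]_n := \matrix_(i, j) star (X j i).

Let smulmxA : associative smulmx.
Proof.
move=> X Y Z; apply/matrixP => i j; rewrite !mxE.
under eq_bigr do rewrite mxE smul_sumr.
under [RHS]eq_bigr do rewrite mxE smul_suml.
rewrite exchange_big /=; apply: eq_bigr => k _.
by apply: eq_bigr => l _; rewrite smulA.
Qed.

Let smulmxDl : left_distributive smulmx +%R.
Proof.
move=> X Y Z; apply/matrixP => i j; rewrite !mxE -big_split /=.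
by apply: eq_bigr => k _; rewrite mxE smulDl.
Qed.

Let smulmxDr : right_distributive smulmx +%R.
Proof.
move=> X Y Z; apply/matrixP => i j; rewrite !mxE -big_split /=.
by apply: eq_bigr => k _; rewrite mxE smulDr.
Qed.

Let starmxD : {morph starmx : X Y / X + Y}.
Proof. by move=> X Y; apply/matrixP => i j; rewrite !mxE starD. Qed.

Let starmxM X Y : starmx (smulmx X Y) = smulmx (starmx Y) (starmx X).
Proof.
apply/matrixP => i j; rewrite !mxE star_sum.
by apply: eq_bigr => k _; rewrite !mxE starM.
Qed.

Let starmxK : involutive starmx.
Proof. by move=> X; apply/matrixP => i j; rewrite !mxE starK. Qed.

HB.instance Definition _ := Zmodule_isStarRng.Build 'M[S]_n
  smulmxA smulmxDl smulmxDr starmxD starmxM starmxK.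

End MatrixStarRng.

(* The positive cone of a *-ring: the additive monoid generated by the elements
   y^* y. In C*-algebras, real or complex, such a sum is itself of the form
   y^* y. *)
Definition positive (S : starRngType) (x : S) : Prop :=
  exists s : seq S, x = \sum_(y <- s) star y ** y.

(* Complete positivity; the additivity and (real or complex) homogeneity of f are
   carried by its type wherever cp is used. map_mx f is the entrywise
   amplification M_n(S) -> M_n(T). *)
Definition cp (S T : starRngType) (f : S -> T) : Prop :=
  forall (n : nat) (X : 'M[S]_n), positive X -> positive (map_mx f X).

(* Real-linear maps from a real space to a complex one. *)
Notation "{ 'rlinear' U -> V }" :=
  {linear U%type -> V%type | (real_complex _ \; *:%R)}
  (U at level 98, V at level 99, format "{ 'rlinear'  U  ->  V }") : type_scope.

Section RealForm.
Variables (R : realType) (A : cstarAlgType R).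

(* Bijectivity follows from antiInvolK. *)
Record antiInvol := AntiInvol {
  antiInvol_fun :> {linear A -> A};
  antiInvol_star : forall a, antiInvol_fun (star a) = star (antiInvol_fun a);
  antiInvolM : forall a b,
    antiInvol_fun (a ** b) = antiInvol_fun b ** antiInvol_fun a;
  antiInvolK : involutive antiInvol_fun
}.

Variable Phi : antiInvol.

Definition realform_pred : {pred A} := fun a => Phi a == star a.

Lemma realform_predP a : reflect (Phi a = star a) (a \in realform_pred).
Proof. exact: eqP. Qed.

Lemma realform_zmod_closed : zmod_closed realform_pred.
Proof.
split=> [|a b /realform_predP ha /realform_predP hb]; apply/realform_predP.
  by rewrite linear0 star0.
by rewrite linearB ha hb starD starN.
Qed.

HB.instance Definition _ :=
  GRing.isZmodClosed.Build A realform_pred realform_zmod_closed.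

(* A_Phi = {a | Phi a = a^*}, a real vector space and a *-ring. *)
Record realform := RealForm {
  rfval :> A;
  rfvalP : rfval \in realform_pred
}.

HB.instance Definition _ := [isSub for rfval].
HB.instance Definition _ := [Choice of realform by <:].
HB.instance Definition _ := [SubChoice_isSubZmodule of realform by <:].

Lemma realform_scale_subproof (r : R) (a : realform) :
  r%:C *: rfval a \in realform_pred.
Proof.
apply/realform_predP; rewrite linearZ_LR starZ (realform_predP _ (rfvalP a)).
by rewrite conjc_real.
Qed.

Definition realform_scale (r : R) (a : realform) : realform :=
  RealForm (realform_scale_subproof r a).

Let scaleA r s a :
  realform_scale r (realform_scale s a) = realform_scale (r * s) a.
Proof. by apply: val_inj; rewrite /= scalerA rmorphM. Qed.

Let scale1 : left_id 1 realform_scale.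
Proof. by move=> a; apply: val_inj; rewrite /= rmorph1 scale1r. Qed.

Let scaleDr : right_distributive realform_scale +%R.
Proof. by move=> r a b; apply: val_inj; rewrite /= scalerDr. Qed.

Let scaleDl a : {morph realform_scale^~ a : r s / r + s}.
Proof. by move=> r s; apply: val_inj; rewrite /= rmorphD scalerDl. Qed.

HB.instance Definition _ := GRing.Zmodule_isLmodule.Build R realform
  scaleA scale1 scaleDr scaleDl.

Lemma realform_mul_subproof (a b : realform) :
  rfval a ** rfval b \in realform_pred.
Proof.
apply/realform_predP.
by rewrite antiInvolM !(realform_predP _ (rfvalP _)) starM.
Qed.

Lemma realform_star_subproof (a : realform) : star (rfval a) \in realform_pred.
Proof.
by apply/realform_predP; rewrite antiInvol_star (realform_predP _ (rfvalP a)).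
Qed.

Definition realform_mul (a b : realform) := RealForm (realform_mul_subproof a b).
Definition realform_star (a : realform) := RealForm (realform_star_subproof a).

Let mulA : associative realform_mul.
Proof. by move=> a b c; apply: val_inj; rewrite /= smulA. Qed.
Let mulDl : left_distributive realform_mul +%R.
Proof. by move=> a b c; apply: val_inj; rewrite /= smulDl. Qed.
Let mulDr : right_distributive realform_mul +%R.
Proof. by move=> a b c; apply: val_inj; rewrite /= smulDr. Qed.
Let rstarD : {morph realform_star : a b / a + b}.
Proof. by move=> a b; apply: val_inj; rewrite /= starD. Qed.
Let rstarM a b :
  realform_star (realform_mul a b)
  = realform_mul (realform_star b) (realform_star a).
Proof. by apply: val_inj; rewrite /= starM. Qed.
Let rstarK : involutive realform_star.
Proof. by move=> a; apply: val_inj; rewrite /= starK. Qed.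

HB.instance Definition _ := Zmodule_isStarRng.Build realform
  mulA mulDl mulDr rstarD rstarM rstarK.

(* x = realpart x + i imagpart x is the decomposition A = A_Phi + i A_Phi. *)
Lemma realpart_subproof (x : A) :
  (2^-1 : R[i]) *: (x + star (Phi x)) \in realform_pred.
Proof.
apply/realform_predP; rewrite linearZ_LR starZ linearD starD antiInvol_star.
by rewrite antiInvolK starK addrC fmorphV rmorph_nat.
Qed.

Definition realpart (x : A) : realform := RealForm (realpart_subproof x).
Definition imagpart (x : A) : realform := realpart ((- 'i) *: x).

Lemma half_add (y : A) : (2^-1 : R[i]) *: (y + y) = y.
Proof.
rewrite scalerDr -scalerDl -mulr2n -(mulr_natl 2^-1 2).
by rewrite divff ?scale1r // pnatr_eq0.
Qed.

Lemma realpart_realform (a : realform) : realpart a = a.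
Proof.
apply: val_inj => /=; rewrite (realform_predP _ (rfvalP a)) starK.
exact: half_add.
Qed.

Lemma realimagE (x : A) : x = rfval (realpart x) + 'i *: rfval (imagpart x).
Proof.
rewrite /= [Phi (_ *: _)]linearZ_LR starZ.
have -> : (- 'i)^*%C = 'i :> R[i] by rewrite /conjc /= oppr0 opprK.
rewrite [in X in _ + X]scalerA [_ * 2^-1]mulrC -scalerA [in X in _ + X]scalerDr !scalerA.
rewrite mulrN -expr2 sqr_i opprK scale1r scaleN1r -scalerDr.
by rewrite addrACA subrr addr0 half_add.
Qed.

Lemma realpartD : {morph realpart : x y / x + y}.
Proof.
move=> x y; apply: val_inj; rewrite /= [Phi (_ + _)]linearD starD addrACA.
by rewrite scalerDr.
Qed.

Lemma realpartZ (r : R) x : realpart (r%:C *: x) = r *: realpart x.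
Proof.
apply: val_inj; rewrite /= [Phi (_ *: _)]linearZ_LR starZ conjc_real.
by rewrite -scalerDr !scalerA mulrC.
Qed.

Lemma imagpartD : {morph imagpart : x y / x + y}.
Proof. by move=> x y; rewrite /imagpart scalerDr realpartD. Qed.

Lemma imagpartZ (r : R) x : imagpart (r%:C *: x) = r *: imagpart x.
Proof. by rewrite /imagpart scalerA mulrC -scalerA realpartZ. Qed.

Lemma imagpart_i x : imagpart ('i *: x) = realpart x.
Proof. by rewrite /imagpart scalerA mulNr -expr2 sqr_i opprK scale1r. Qed.

Lemma realpart_i x : realpart ('i *: x) = - imagpart x.
Proof.
have -> : 'i *: x = (-1)%:C *: ((- 'i) *: x).
  by rewrite scalerA rmorphN rmorph1 mulrNN mul1r.
by rewrite realpartZ scaleN1r.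
Qed.

Lemma imagpart_realform (a : realform) : imagpart a = 0.
Proof.
have conj_i : (- 'i)^*%C = 'i :> R[i] by rewrite /conjc /= oppr0 opprK.
apply: val_inj; rewrite /= [Phi (_ *: _)]linearZ_LR starZ conj_i.
by rewrite (realform_predP _ (rfvalP a)) starK -scalerDl addNr scale0r scaler0.
Qed.

End RealForm.

(* The complex-linear extension a + i b |-> f a + i f b of f; see complexifyE. *)
Section Complexification.
Variables (R : realType) (A : cstarAlgType R) (Phi : antiInvol A).
Variables (V : lmodType R[i]) (f : {rlinear realform Phi -> V}).

Definition complexify (x : A) : V :=
  f (realpart Phi x) + 'i *: f (imagpart Phi x).

Lemma complexify_is_linear : linear complexify.
Proof.
have fD a b : f (a + b) = f a + f b by rewrite linearD.
have fN a : f (- a) = - f a by rewrite linearN.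
have fZ (r : R) a : f (r *: a) = r%:C *: f a by rewrite linearZ_LR.
have cD x y : complexify (x + y) = complexify x + complexify y.
  by rewrite /complexify realpartD imagpartD !fD scalerDr addrACA.
have cZ (r : R) x : complexify (r%:C *: x) = r%:C *: complexify x.
  by rewrite /complexify realpartZ imagpartZ !fZ scalerDr !scalerA mulrC.
have ci x : complexify ('i *: x) = 'i *: complexify x.
  rewrite /complexify realpart_i imagpart_i fN scalerDr scalerA -expr2 sqr_i.
  by rewrite scaleN1r addrC.
by move=> k x y; rewrite cD [k]complexE !scalerDl cD -!scalerA ci !cZ.
Qed.

HB.instance Definition _ :=
  GRing.isLinear.Build R[i] A V *:%R complexify complexify_is_linear.

Lemma complexifyE (a b : realform Phi) :
  complexify (rfval a + 'i *: rfval b) = f a + 'i *: f b.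
Proof.
rewrite /complexify realpartD imagpartD realpart_i imagpart_i.
by rewrite !realpart_realform !imagpart_realform oppr0 addr0 add0r.
Qed.

End Complexification.

Section Multiplier.
Variables (R : realType) (B : cstarAlgType R).

Lemma smul_inj (x y : B) : (forall a : B, a ** x = a ** y) -> x = y.
Proof.
move=> h; apply/eqP; rewrite -subr_eq0 -normr_eq0 -sqrf_eq0 -norm_star_smul.
by rewrite smulDr smulrN h subrr normr0.
Qed.

Lemma smul_injr (x y : B) : (forall a : B, x ** a = y ** a) -> x = y.
Proof.
move=> h; rewrite -[x]starK -[y]starK; congr star; apply: smul_inj => a.
by rewrite -[a]starK -!starM h.
Qed.

(* Double centralizers (L, R) in the sense of Johnson and Busby; linearity,
   boundedness and L (a b) = L a b, R (a b) = a R b are automatic. *)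
Definition dcentralizer : {pred (B -> B) * (B -> B)} :=
  fun LR => `[< forall a b : B, a ** LR.1 b = LR.2 a ** b >].

Lemma dcentralizerP (LR : (B -> B) * (B -> B)) :
  reflect (forall a b : B, a ** LR.1 b = LR.2 a ** b) (LR \in dcentralizer).
Proof. exact: asboolP. Qed.

Lemma dcentralizer_submod_closed : submod_closed dcentralizer.
Proof.
split=> [|k T U /dcentralizerP hT /dcentralizerP hU]; apply/dcentralizerP=> a b.
  by rewrite /= smul0r smulr0.
by rewrite /= smulDr smulDl scale_smull scale_smulr hT hU.
Qed.

HB.instance Definition _ := GRing.isSubmodClosed.Build R[i]
  ((B -> B) * (B -> B))%type dcentralizer dcentralizer_submod_closed.

Record multiplier := Multiplier {
  mval : (B -> B) * (B -> B);
  mvalP : mval \in dcentralizer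
}.

HB.instance Definition _ := [isSub for mval].
HB.instance Definition _ := [Choice of multiplier by <:].
HB.instance Definition _ := [SubChoice_isSubLmodule of multiplier by <:].

Definition lmult (T : multiplier) : B -> B := (mval T).1.
Definition rmult (T : multiplier) : B -> B := (mval T).2.

Lemma multE (T : multiplier) a b : a ** lmult T b = rmult T a ** b.
Proof. exact: (dcentralizerP _ (mvalP T)). Qed.

Lemma multiplier_eq (T U : multiplier) :
  (forall b, lmult T b = lmult U b) -> T = U.
Proof.
move=> h; apply: val_inj; case: T U h => [[L1 R1] h1] [[L2 R2] h2] /= h.
have e : L1 = L2 by apply/funext => b; exact: h.
congr (_, _) => //; apply/funext => b; apply: smul_injr => c.
by rewrite -[_ ** _](dcentralizerP _ h1) -[RHS](dcentralizerP _ h2) /= e.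
Qed.

Lemma lmultD (T : multiplier) : {morph lmult T : a b / a + b}.
Proof. by move=> a b; apply: smul_inj => c; rewrite smulDr !multE smulDr. Qed.

Lemma lmultM (T : multiplier) a b : lmult T (a ** b) = lmult T a ** b.
Proof. by apply: smul_inj => c; rewrite smulA !multE smulA. Qed.

Lemma mul_subproof (T U : multiplier) :
  (lmult T \o lmult U, rmult U \o rmult T) \in dcentralizer.
Proof. by apply/dcentralizerP => a b; rewrite /= !multE. Qed.

Lemma star_subproof (T : multiplier) :
  (fun b => star (rmult T (star b)), fun b => star (lmult T (star b)))
    \in dcentralizer.
Proof.
by apply/dcentralizerP=> a b; rewrite /= -[a in LHS]starK -starM -multE starM starK.
Qed.

Definition multiplier_mul (T U : multiplier) : multiplier :=
  Multiplier (mul_subproof T U).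
Definition multiplier_star (T : multiplier) : multiplier :=
  Multiplier (star_subproof T).

Let mmulA : associative multiplier_mul.
Proof. by move=> T U W; apply: multiplier_eq. Qed.
Let mmulDl : left_distributive multiplier_mul +%R.
Proof. by move=> T U W; apply: multiplier_eq. Qed.
Let mmulDr : right_distributive multiplier_mul +%R.
Proof. by move=> T U W; apply: multiplier_eq => b; exact: lmultD. Qed.
Let mstarD : {morph multiplier_star : T U / T + U}.
Proof. by move=> T U; apply: multiplier_eq => b; exact: starD. Qed.
Let mstarM T U : multiplier_star (multiplier_mul T U)
  = multiplier_mul (multiplier_star U) (multiplier_star T).
Proof.
apply: multiplier_eq => b.
exact: (congr1 (fun c : B => star (rmult U c)) (esym (starK (rmult T (star b))))).
Qed.
Let mstarK : involutive multiplier_star.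
Proof.
move=> T; apply: multiplier_eq => b.
exact: etrans (starK _) (congr1 (lmult T) (starK b)).
Qed.

HB.instance Definition _ := Zmodule_isStarRng.Build multiplier
  mmulA mmulDl mmulDr mstarD mstarM mstarK.

Lemma mult_of_subproof (b : B) : (smul b, smul^~ b) \in dcentralizer.
Proof. by apply/dcentralizerP => a c; rewrite /= smulA. Qed.

(* The embedding of B as an ideal of its multiplier algebra. *)
Definition mult_of (b : B) : multiplier := Multiplier (mult_of_subproof b).

(* b^* T b, which is an element of B. *)
Definition compress (b : B) (T : multiplier) : B := star b ** lmult T b.

Lemma compressE (b : B) (T : multiplier) :
  mult_of (compress b T) = star (mult_of b) ** T ** mult_of b.
Proof.
apply: multiplier_eq => c.
have lmM (U W : multiplier) (x : B) : lmult (U ** W) x = lmult U (lmult W x).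
  by [].
have lmof (x y : B) : lmult (mult_of x) y = x ** y by [].
rewrite !lmM !lmof lmultM.
have -> x : lmult (star (mult_of b)) x = star b ** x.
  exact: etrans (starM _ _) (congr1 _ (starK x)).
by rewrite smulA.
Qed.

Lemma compress_is_linear b : linear (compress b).
Proof. by move=> k T U; rewrite /compress -scale_smulr -smulDr. Qed.

HB.instance Definition _ b := GRing.isLinear.Build R[i] multiplier B *:%R
  (compress b) (compress_is_linear b).

End Multiplier.

Notation "'M(' B ')'" := (multiplier B) (format "'M(' B ')'") : type_scope.

Section RealCompression.
Variables (R : realType) (A : cstarAlgType R) (Phi : antiInvol A).
Variables (B : cstarAlgType R) (b : B) (f : {rlinear realform Phi -> M(B)}).

Definition rcompress (a : realform Phi) : B := compress b (f a).

Lemma rcompress_is_linear :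
  linear_for (real_complex R \; *:%R) rcompress.
Proof. by move=> r x y; rewrite /rcompress linearD linearZ_LR /= linearD linearZ_LR. Qed.

HB.instance Definition _ := GRing.isLinear.Build R (realform Phi) B
  (real_complex R \; *:%R) rcompress rcompress_is_linear.

End RealCompression.

Section Nuclear.
Variable R : realType.
Variables (A B : cstarAlgType R) (Phi : antiInvol A).

(* theta is the limit, pointwise in norm, of a net of maps in P; nets are
   rendered by proper filters. *)
Definition point_norm_limit (X : Type) (P : set (X -> B)) (theta : X -> B) :=
  exists F : set_system (X -> B), [/\ ProperFilter F, F P &
    forall x, (fun f => f x) @ F --> theta x].

Definition matrix_factored : set (A -> B) := [set f |
  exists (n : nat) (phi : {linear A -> 'M[R[i]]_n})
    (psi : {linear 'M[R[i]]_n -> B}), [/\ cp phi, cp psi & f = psi \o phi]].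

Definition matrix_factored_real : set (realform Phi -> B) := [set f |
  exists (n : nat) (phi : {linear realform Phi -> 'M[R^o]_n})
    (psi : {rlinear 'M[R^o]_n -> B}), [/\ cp phi, cp psi & f = psi \o phi]].

Definition nuclear (theta : {linear A -> B}) : Prop :=
  cp theta /\ point_norm_limit matrix_factored theta.

Definition nuclear_real (theta : {rlinear realform Phi -> B}) : Prop :=
  cp theta /\ point_norm_limit matrix_factored_real theta.

Definition weakly_nuclear (phi : {linear A -> M(B)}) : Prop :=
  cp phi /\ forall b : B, nuclear (compress b \o phi).

Definition weakly_nuclear_real (phi : {rlinear realform Phi -> M(B)}) : Prop :=
  cp phi /\ forall b : B, nuclear_real (rcompress b phi).

End Nuclear.

(* Main.v *)
(* A c.p. map of A_Phi has a c.p. complexification: for x = p + i q the element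
   x^* x is v^* w^* w v, where w is the row (p, q) over A_Phi and v the scalar
   column (1, i), so its image is the compression by v of the positive matrix
   phi(w^* w). The same holds for M_n(R) inside M_n(C); hence complexification
   turns a factorization through M_n(R) into one through M_n(C). Conversely
   M_n(C) embeds as a real *-algebra in M_2n(R), and compression by v / sqrt 2
   is a c.p. left inverse of this embedding, so the restriction to A_Phi of a
   map factoring through M_n(C) factors through M_2n(R). Complexification and
   restriction are point-norm continuous and mutually inverse, and complexifying
   commutes with compressing by b. *)

Require Import Defs.
From HB Require Import structures.
From mathcomp Require Import all_boot all_order all_algebra.
From mathcomp Require Import complex.
From mathcomp Require Import all_classical all_reals all_analysis.

Set Implicit Arguments.
Unset Strict Implicit.
Unset Printing Implicit Defensive.

Import Order.TTheory GRing.Theory Num.Theory.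
Import numFieldNormedType.Exports.

Local Open Scope classical_set_scope.
Local Open Scope ring_scope.
Local Open Scope complex_scope.

(** * Additive maps and their entrywise amplifications *)

Lemma morphD0 (U V : zmodType) (f : U -> V) :
  {morph f : x y / x + y} -> f 0 = 0.
Proof. by move=> fD; apply: (addIr (f 0)); rewrite -fD !add0r. Qed.

Lemma morphDN (U V : zmodType) (f : U -> V) :
  {morph f : x y / x + y} -> {morph f : x / - x}.
Proof. by move=> fD x; apply: (addIr (f x)); rewrite -fD !addNr morphD0. Qed.

Lemma morphD_sum (U V : zmodType) (f : U -> V) (I : Type) (r : seq I)
    (F : I -> U) :
  {morph f : x y / x + y} ->
  f (\sum_(i <- r) F i) = \sum_(i <- r) f (F i).
Proof. by move=> fD; apply: big_morph => //; exact: morphD0. Qed.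

Lemma map_mxD_morph (U V : zmodType) (f : U -> V) m n :
  {morph f : x y / x + y} ->
  {morph @map_mx U V f m n : X Y / X + Y}.
Proof. by move=> fD X Y; apply/matrixP => i j; rewrite !mxE fD. Qed.

Lemma smulmxE (S : starRngType) n (X Y : 'M[S]_n) i j :
  (X ** Y) i j = \sum_k X i k ** Y k j.
Proof. by rewrite mxE. Qed.

Lemma starmxE (S : starRngType) n (X : 'M[S]_n) i j : (star X) i j = star (X j i).
Proof. by rewrite mxE. Qed.

Lemma map_mx_smul (S T : starRngType) (f : S -> T) n :
  {morph f : x y / x + y} -> {morph f : x y / x ** y} ->
  {morph @map_mx S T f n n : X Y / X ** Y}.
Proof.
move=> fD fM X Y; apply/matrixP => i j; rewrite mxE !smulmxE morphD_sum //.
by apply: eq_bigr => k _; rewrite !mxE fM.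
Qed.

(** * Sums of squares and criteria for complete positivity *)

Section Positive.
Variable S : starRngType.

Lemma positive_sum (I : Type) (r : seq I) (F : I -> S) :
  (forall i, positive (F i)) -> positive (\sum_(i <- r) F i).
Proof.
move=> F_pos; elim/big_ind: _ => //; first by exists [::]; rewrite big_nil.
by move=> _ _ [s ->] [t ->]; exists (s ++ t); rewrite big_cat.
Qed.

Lemma positive_smul (y : S) : positive (star y ** y).
Proof. by exists [:: y]; rewrite big_seq1. Qed.

End Positive.

Section Kernel.
Variables (S T : starRngType) (f : S -> T) (gs : seq (S -> T)).
Hypothesis fD : {morph f : x y / x + y}.
Hypothesis f_kernel :
  forall x y, f (star x ** y) = \sum_(g <- gs) star (g x) ** g y.

(** On the diagonal x = y the kernel identity writes f(x^* x) as a sum of squares; additivity does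
    the rest. *)
Lemma positive_kernel x : positive x -> positive (f x).
Proof.
move=> [s ->]; rewrite morphD_sum //; apply: positive_sum => y.
by rewrite f_kernel; apply: positive_sum => g; exact: positive_smul.
Qed.

End Kernel.

(** A Kraus-type identity is inherited by every amplification: applying each g entrywise gives the
    same identity over matrices, so [positive_kernel] works at each size. *)
Lemma cp_kernel (S T : starRngType) (f : S -> T) (gs : seq (S -> T)) :
  {morph f : x y / x + y} ->
  (forall x y, f (star x ** y) = \sum_(g <- gs) star (g x) ** g y) -> cp f.
Proof.
move=> fD fK n; apply: (@positive_kernel _ _ _
  [seq @map_mx S T g n n | g <- gs]); first exact: map_mxD_morph.
move=> X Y; apply/matrixP => i j; rewrite big_map mxE smulmxE morphD_sum //.
rewrite summxE; under [RHS]eq_bigr do rewrite smulmxE.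
rewrite [RHS]exchange_big; apply: eq_bigr => k _ /=.
by rewrite starmxE fK; apply: eq_bigr => g _; rewrite starmxE !mxE.
Qed.

Lemma cp_starhom (S T : starRngType) (f : S -> T) :
  {morph f : x y / x + y} -> (forall x y, f (star x ** y) = star (f x) ** f y) ->
  cp f.
Proof.
by move=> fD fM; apply: (@cp_kernel _ _ _ [:: f]) => // x y; rewrite big_seq1.
Qed.

Lemma cp_comp (S T U : starRngType) (g : T -> U) (f : S -> T) :
  cp g -> cp f -> cp (g \o f).
Proof. by move=> cg cf n X /cf /cg; rewrite -map_mx_comp. Qed.

(** Here h is halving: x^* y / 2 is twice (x/2)^* (y/2), a kernel with two equal terms that avoids a
    square root of 1/2. *)
Lemma cp_half (T : starRngType) (h : T -> T) :
  {morph h : x y / x + y} -> (forall x, h x + h x = x) ->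
  (forall x y, h (x ** y) = h x ** y) -> (forall x y, h (x ** y) = x ** h y) ->
  (forall x, star (h x) = h (star x)) -> cp h.
Proof.
move=> hD h2 hl hr hs; apply: (@cp_kernel _ _ _ [:: h; h]) => // x y.
by rewrite big_cons big_seq1 hs -hl -hr h2.
Qed.

(** * Compression by the column (1, i) and complexification of c.p. maps *)

Section ImaginaryUnit.
Variables (T : starRngType) (J : T -> T).
Hypothesis JD : {morph J : x y / x + y}.
Hypothesis JJ : forall x, J (J x) = - x.
Hypothesis J_smull : forall x y, J x ** y = J (x ** y).
Hypothesis J_smulr : forall x y, x ** J y = J (x ** y).
Hypothesis starJ : forall x, star (J x) = - J (star x).

(* The compression v^* W v by the block column v = (1, J). *)
Definition col1i n (W : 'M[T]_(n + n)) : 'M[T]_n :=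
  ulsubmx W + map_mx J (ursubmx W) + (drsubmx W - map_mx J (dlsubmx W)).

Lemma col1iE n (W : 'M[T]_(n + n)) i j :
  col1i W i j = W (lshift n i) (lshift n j) + J (W (lshift n i) (rshift n j))
    + (W (rshift n i) (rshift n j) - J (W (rshift n i) (lshift n j))).
Proof. by rewrite !mxE. Qed.

Lemma col1iD n : {morph @col1i n : X Y / X + Y}.
Proof.
move=> X Y; apply/matrixP => i j; rewrite !mxE !JD opprD.
by rewrite (AC ((2*2)*(2*2)) (((1*3)*(5*7))*((2*4)*(6*8)))).
Qed.

(** This expansion serves the compression below as well as the products in M_n(C) = M_n(R) + i
    M_n(R) and A = A_Phi + i A_Phi. *)
Lemma star_smul1i (x1 x2 y1 y2 : T) :
  star (x1 + J x2) ** (y1 + J y2) =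
  star x1 ** y1 + J (star x1 ** y2) + (star x2 ** y2 - J (star x2 ** y1)).
Proof.
rewrite starD starJ smulDl !smulDr !smulNr !J_smull !J_smulr JJ opprK.
by rewrite [- _ + _]addrC.
Qed.

(** [g1] and [g2] are the two blocks of the column X v, and v^* X^* Y v = (X v)^* (Y v). *)
Lemma col1i_kernel n (X Y : 'M[T]_(n + n)) :
  let g1 W := ulsubmx W + map_mx J (ursubmx W) in
  let g2 W := dlsubmx W + map_mx J (drsubmx W) in
  col1i (star X ** Y) = \sum_(g <- [:: g1; g2]) star (g X) ** g Y.
Proof.
move=> g1 g2; rewrite big_cons big_seq1; apply/matrixP => i j.
have blockE p q : (star X ** Y) p q
    = \sum_(k < n) star (X (lshift n k) p) ** Y (lshift n k) q
      + \sum_(k < n) star (X (rshift n k) p) ** Y (rshift n k) q.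
  rewrite smulmxE big_split_ord /=.
  by congr (_ + _); apply: eq_bigr => k _; rewrite starmxE.
have gE (X' Y' : 'M[T]_n) : (star X' ** Y') i j = \sum_k star (X' k i) ** Y' k j.
  by rewrite smulmxE; apply: eq_bigr => k _; rewrite starmxE.
rewrite [RHS]mxE !gE.
under [X in _ = X + _]eq_bigr do rewrite !mxE star_smul1i.
under [X in _ = _ + X]eq_bigr do rewrite !mxE star_smul1i.
rewrite !big_split /= !sumrN -!morphD_sum //.
rewrite col1iE !blockE !JD opprD.
by rewrite (AC ((2*2)*(2*2)) (((1*3)*(5*7))*((2*4)*(6*8)))).
Qed.

Lemma cp_col1i n : cp (@col1i n).
Proof. exact: (cp_kernel (@col1iD n) (@col1i_kernel n)). Qed.

Section Complexification.
Variables (C S : starRngType) (re im : C -> S) (f : S -> T).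
Hypothesis reD : {morph re : x y / x + y}.
Hypothesis imD : {morph im : x y / x + y}.
Hypothesis re_smul : forall x y,
  re (star x ** y) = star (re x) ** re y + star (im x) ** im y.
Hypothesis im_smul : forall x y,
  im (star x ** y) = star (re x) ** im y - star (im x) ** re y.
Hypothesis fD : {morph f : x y / x + y}.

(** [C] stands for the complexification of [S], so that one argument covers both A_Phi in A and
    M_n(R) in M_n(C). *)
Lemma cp_complexification : cp f -> cp (fun x => f (re x) + J (f (im x))).
Proof.
move=> f_cp n X [s ->]; rewrite morphD_sum; last first.
  by apply: map_mxD_morph => x y; rewrite reD imD !fD JD addrACA.
apply: positive_sum => Y.
(* The block row (p, q) of real and imaginary parts of Y, padded with zeros to a square matrix,
   because positivity is defined in a single *-ring. *)
pose W : 'M[S]_(n + n) := block_mx (map_mx re Y) (map_mx im Y) 0 0.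
have Wl k j : W (lshift n k) (lshift n j) = re (Y k j).
  by rewrite block_mxEul mxE.
have Wr k j : W (lshift n k) (rshift n j) = im (Y k j).
  by rewrite block_mxEur mxE.
have -> : map_mx (fun x => f (re x) + J (f (im x))) (star Y ** Y)
    = col1i (map_mx f (star W ** W)).
  apply/matrixP => i j.
  have WE p q : (star W ** W) p q
      = \sum_(k < n) star (W (lshift n k) p) ** W (lshift n k) q.
    rewrite smulmxE big_split_ord /= [X in _ + X]big1 ?addr0 => [|k _].
      by apply: eq_bigr => k _; rewrite starmxE.
    rewrite starmxE /W; case: (split_ordP q) => q' ->.
      by rewrite block_mxEdl !mxE smulr0.
    by rewrite block_mxEdr !mxE smulr0.
  rewrite mxE smulmxE (morphD_sum _ _ reD) (morphD_sum _ _ imD).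
  under eq_bigr do rewrite starmxE re_smul.
  under [X in _ + J (f X)]eq_bigr do rewrite starmxE im_smul.
  rewrite col1iE ![map_mx f _ _ _]mxE !WE.
  under [X in _ = f X + _ + _]eq_bigr do rewrite !Wl.
  under [X in _ = _ + J (f X) + _]eq_bigr do rewrite Wl Wr.
  under [X in _ = _ + (f X - _)]eq_bigr do rewrite !Wr.
  under [X in _ = _ + (_ - J (f X))]eq_bigr do rewrite Wl Wr.
  rewrite !big_split /= sumrN !fD !(morphDN fD) JD (morphDN JD).
  exact: addrACA.
(* The compression already acts at the amplified size, so its plain positivity suffices. *)
by apply: (positive_kernel (@col1iD n) (@col1i_kernel n)); apply/f_cp/positive_smul.
Qed.

End Complexification.
End ImaginaryUnit.

(** * Multiplication by i in the algebras at hand *)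

Section Scalars.
Variable R : realType.

Lemma conjc_i : 'i^*%C = - 'i :> R[i].
Proof. by apply/eqP; rewrite eq_complex /= oppr0 !eqxx. Qed.

Lemma star_imulC (x : R[i]) : star ('i * x) = - 'i * star x.
Proof. by rewrite -conjc_i; exact: (rmorphM (@conjc R)). Qed.

(** A central skew-adjoint square root of -1, given as an operator because a non-unital algebra has
    no element i. *)
Definition imaginary_unit (T : starRngType) (J : T -> T) : Prop :=
  [/\ {morph J : x y / x + y},
      forall x, J (J x) = - x,
      forall x y, J x ** y = J (x ** y),
      forall x y, x ** J y = J (x ** y)
    & forall x, star (J x) = - J (star x)].

Lemma scale_iK (V : lmodType R[i]) (x : V) : 'i *: ('i *: x) = - x.
Proof. by rewrite scalerA -expr2 sqr_i scaleN1r. Qed.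

Lemma cstar_imaginary_unit (B : cstarAlgType R) :
  imaginary_unit (fun x : B => 'i *: x).
Proof.
split=> [x y|x|x y|x y|x].
- exact: scalerDr.
- exact: scale_iK.
- exact: scale_smull.
- exact: scale_smulr.
- by rewrite starZ conjc_i scaleNr.
Qed.

Lemma lmult_smul (B : cstarAlgType R) (T U : M(B)) (b : B) :
  lmult (T ** U) b = lmult T (lmult U b).
Proof. by []. Qed.

Lemma lmult_star (B : cstarAlgType R) (T : M(B)) (b : B) :
  lmult (star T) b = star (rmult T (star b)).
Proof. by []. Qed.

Lemma lmultS (B : cstarAlgType R) (T : M(B)) (k : R[i]) (b : B) :
  lmult (k *: T) b = k *: lmult T b.
Proof. by []. Qed.

Lemma rmultS (B : cstarAlgType R) (T : M(B)) (k : R[i]) (b : B) :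
  rmult (k *: T) b = k *: rmult T b.
Proof. by []. Qed.

(** Left multiplication by an arbitrary c moves T onto c, where the scalar can be pulled out; this
    lets i pass through T in a product T (i U). *)
Lemma lmultZ (B : cstarAlgType R) (T : M(B)) (k : R[i]) (b : B) :
  lmult T (k *: b) = k *: lmult T b.
Proof. by apply: smul_inj => c; rewrite scale_smulr !Defs.multE scale_smulr. Qed.

Lemma multiplier_imaginary_unit (B : cstarAlgType R) :
  imaginary_unit (fun T : M(B) => 'i *: T).
Proof.
split=> [x y|x|x y|x y|x].
- exact: scalerDr.
- exact: scale_iK.
- by apply: multiplier_eq => b; rewrite lmultS !lmult_smul lmultS.
- by apply: multiplier_eq => b; rewrite lmultS !lmult_smul lmultS lmultZ.
- apply: multiplier_eq => b.
  by rewrite -scaleNr lmultS !lmult_star rmultS starZ conjc_i.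
Qed.

Lemma scalemx_smull n (k : R[i]) (X Y : 'M[R[i]]_n) :
  (k *: X) ** Y = k *: (X ** Y).
Proof.
apply/matrixP => i j; rewrite smulmxE [RHS]mxE smulmxE mulr_sumr.
by apply: eq_bigr => l _; rewrite mxE; exact: esym (mulrA _ _ _).
Qed.

Lemma scalemx_smulr n (k : R[i]) (X Y : 'M[R[i]]_n) :
  X ** (k *: Y) = k *: (X ** Y).
Proof.
apply/matrixP => i j; rewrite smulmxE [RHS]mxE smulmxE mulr_sumr.
by apply: eq_bigr => l _; rewrite mxE; exact: mulrCA.
Qed.

Lemma starmxZ n (k : R[i]) (X : 'M[R[i]]_n) : star (k *: X) = k^*%C *: star X.
Proof. by apply/matrixP => i j; rewrite !mxE; exact: (rmorphM (@conjc R)). Qed.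

Lemma mx_imaginary_unit n : imaginary_unit (fun X : 'M[R[i]]_n => 'i *: X).
Proof.
split=> [x y|x|x y|x y|x].
- exact: scalerDr.
- exact: scale_iK.
- exact: scalemx_smull.
- exact: scalemx_smulr.
- by rewrite starmxZ conjc_i scaleNr.
Qed.

Lemma cp_mx_half n : cp (fun X : 'M[R[i]]_n => 2^-1 *: X).
Proof.
apply: cp_half => [X Y|X|X Y|X Y|X].
- exact: scalerDr.
- rewrite -scalerDl -mulr2n -(mulr_natl 2^-1 2).
  by rewrite divff ?scale1r // pnatr_eq0.
- exact: esym (scalemx_smull _ _ _).
- exact: esym (scalemx_smulr _ _ _).
- by rewrite starmxZ fmorphV rmorph_nat.
Qed.

Lemma C_imaginary_unit : imaginary_unit (fun x : R[i] => 'i * x).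
Proof.
split=> [x y|x|x y|x y|x].
- exact: mulrDr.
- by rewrite mulrA -expr2 sqr_i mulN1r.
- exact: esym (mulrA _ _ _).
- exact: mulrCA.
- by rewrite star_imulC mulNr.
Qed.

End Scalars.

(** * Real and imaginary parts of matrices, and M_n(C) inside M_2n(R) *)

Section RealMatrices.
Variables (R : realType) (n : nat).

Definition Cmx (X : 'M[R^o]_n) : 'M[R[i]]_n := map_mx (real_complex R) X.
Definition Remx (Z : 'M[R[i]]_n) : 'M[R^o]_n := map_mx (@complex.Re R) Z.
Definition Immx (Z : 'M[R[i]]_n) : 'M[R^o]_n := map_mx (@complex.Im R) Z.

Lemma CmxD : {morph Cmx : X Y / X + Y}.
Proof. by apply: map_mxD_morph => x y; rewrite rmorphD. Qed.

Lemma RemxD : {morph Remx : X Y / X + Y}.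
Proof. by apply: map_mxD_morph => -[? ?] [? ?]. Qed.

Lemma ImmxD : {morph Immx : X Y / X + Y}.
Proof. by apply: map_mxD_morph => -[? ?] [? ?]. Qed.

Lemma CmxZ r X : Cmx (r *: X) = r%:C *: Cmx X.
Proof. by apply/matrixP => i j; rewrite !mxE -rmorphM. Qed.

Lemma RemxE X Y : Remx (Cmx X + 'i *: Cmx Y) = X.
Proof.
by apply/matrixP => i j; rewrite !mxE /= mul0r mul1r subr0 addr0.
Qed.

Lemma ImmxE X Y : Immx (Cmx X + 'i *: Cmx Y) = Y.
Proof.
by apply/matrixP => i j; rewrite !mxE /= mul0r mul1r !add0r.
Qed.

Lemma ReImmxE Z : Z = Cmx (Remx Z) + 'i *: Cmx (Immx Z).
Proof. by apply/matrixP => i j; rewrite !mxE -complexE. Qed.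

Lemma CmxM X Y : Cmx (X ** Y) = Cmx X ** Cmx Y.
Proof. by apply: map_mx_smul => x y; [exact: rmorphD | exact: rmorphM].
Qed.

Lemma Cmx_star X : Cmx (star X) = star (Cmx X).
Proof. by apply/matrixP => i j; rewrite !mxE; exact: esym (conjc_real _). Qed.

Lemma CmxB : {morph Cmx : X Y / X - Y}.
Proof. by move=> X Y; rewrite CmxD (morphDN CmxD). Qed.

Lemma cp_Cmx : cp Cmx.
Proof. by apply: (cp_starhom CmxD) => X Y; rewrite CmxM Cmx_star. Qed.

Lemma mx_star_smul X Y :
  star X ** Y =
  Cmx (star (Remx X) ** Remx Y + star (Immx X) ** Immx Y)
  + 'i *: Cmx (star (Remx X) ** Immx Y - star (Immx X) ** Remx Y).
Proof.
have [JD JJ Jl Jr sJ] := mx_imaginary_unit R n.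
rewrite {1}[X]ReImmxE {1}[Y]ReImmxE (star_smul1i JJ Jl Jr sJ).
rewrite CmxD CmxB !CmxM !Cmx_star scalerBr.
exact: addrACA.
Qed.

Lemma Remx_smul X Y :
  Remx (star X ** Y) = star (Remx X) ** Remx Y + star (Immx X) ** Immx Y.
Proof. by rewrite mx_star_smul RemxE. Qed.

Lemma Immx_smul X Y :
  Immx (star X ** Y) = star (Remx X) ** Immx Y - star (Immx X) ** Remx Y.
Proof. by rewrite mx_star_smul ImmxE. Qed.

Lemma RemxZ r Z : Remx (r%:C *: Z) = r *: Remx Z.
Proof.
by apply/matrixP => i j; rewrite !mxE; case: (Z i j) => a b /=; rewrite mul0r subr0.
Qed.

Lemma ImmxZ r Z : Immx (r%:C *: Z) = r *: Immx Z.
Proof.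
by apply/matrixP => i j; rewrite !mxE; case: (Z i j) => a b /=; rewrite mul0r addr0.
Qed.

Lemma Remx_i Z : Remx ('i *: Z) = - Immx Z.
Proof.
by apply/matrixP => i j; rewrite !mxE; case: (Z i j) => a b /=;
  rewrite mul0r mul1r add0r.
Qed.

Lemma Immx_i Z : Immx ('i *: Z) = Remx Z.
Proof.
by apply/matrixP => i j; rewrite !mxE; case: (Z i j) => a b /=;
  rewrite mul0r mul1r add0r.
Qed.

(** The signs are chosen so that the image W of Z satisfies W v = v Z for the column v = (1, i). *)
Definition mx_realify (Z : 'M[R[i]]_n) : 'M[R^o]_(n + n) :=
  block_mx (Remx Z) (Immx Z) (- Immx Z) (Remx Z).

Lemma mx_realifyD : {morph mx_realify : X Y / X + Y}.
Proof.
by move=> X Y; rewrite /mx_realify RemxD ImmxD opprD add_block_mx.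
Qed.

Lemma mx_realifyZ r Z : mx_realify (r%:C *: Z) = r *: mx_realify Z.
Proof. by rewrite /mx_realify RemxZ ImmxZ -scalerN scale_block_mx. Qed.

(** Passing to the transpose and the ordinary product makes block multiplication available. *)
Lemma star_smulmx_real m (X Y : 'M[R^o]_m) : star X ** Y = X^T *m Y.
Proof.
apply/matrixP => i j; rewrite smulmxE mxE.
by apply: eq_bigr => k _; rewrite !mxE.
Qed.

Lemma cp_mx_realify : cp mx_realify.
Proof.
apply: (cp_starhom mx_realifyD) => X Y.
rewrite /mx_realify star_smulmx_real tr_block_mx mulmx_block Remx_smul Immx_smul.
have trN (M : 'M[R^o]_n) : (- M)^T = - M^T.
  by apply/matrixP => i j; rewrite !mxE.
rewrite !star_smulmx_real !trN. rewrite !mulNmx !mulmxN opprK.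
by congr block_mx; rewrite ?opprB // addrC.
Qed.

End RealMatrices.

Section Unrealify.
Variables (R : realType) (n : nat).

(* The compression W |-> v^* W v by the unit column v = (1, i) / sqrt 2 is a
   left inverse of mx_realify. *)
Definition mx_unrealify (W : 'M[R^o]_(n + n)) : 'M[R[i]]_n :=
  2^-1 *: col1i (fun x : R[i] => 'i * x) (Cmx W).

Lemma mx_realifyK : cancel (@mx_realify R n) mx_unrealify.
Proof.
move=> Z; rewrite [RHS]ReImmxE; apply/matrixP => i j.
rewrite /mx_unrealify /Cmx mxE col1iE ![map_mx _ _ _ _]mxE.
(* Each block row contributes p + i q, so the compression gives 2 Z. *)
rewrite block_mxEul block_mxEur block_mxEdl block_mxEdr !mxE rmorphN mulrN opprK.
by rewrite /= -mulr2n -[X in _ * X]mulr_natl mulKf ?pnatr_eq0.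
Qed.
Lemma mx_unrealifyD : {morph mx_unrealify : X Y / X + Y}.
Proof.
have [JD _ _ _ _] := C_imaginary_unit R.
by move=> X Y; rewrite /mx_unrealify CmxD col1iD ?scalerDr.
Qed.

Lemma mx_unrealifyZ r (W : 'M[R^o]_(n + n)) :
  mx_unrealify (r *: W) = r%:C *: mx_unrealify W.
Proof.
rewrite /mx_unrealify CmxZ [RHS]scalerA [_ * 2^-1]mulrC -scalerA; congr (_ *: _).
apply/matrixP => i j; rewrite [RHS]mxE !col1iE ![(_ *: Cmx W) _ _]mxE.
by rewrite !(mulrCA 'i) -mulrBr -!mulrDr.
Qed.

Lemma cp_mx_unrealify : cp (mx_unrealify).
Proof.
have [JD JJ Jl Jr sJ] := C_imaginary_unit R.
apply: (cp_comp (@cp_mx_half R n)).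
exact: (cp_comp (cp_col1i JD JJ Jl Jr sJ (n := n)) (@cp_Cmx R (n + n))).
Qed.

End Unrealify.

(** * Products in A through A_Phi, and complexified c.p. maps *)

Section RealForm.
Variables (R : realType) (A : cstarAlgType R) (Phi : antiInvol A).

Lemma realform_star_smul (p q p' q' : realform Phi) :
  star (rfval p + 'i *: rfval q) ** (rfval p' + 'i *: rfval q') =
  rfval (star p ** p' + star q ** q') + 'i *: rfval (star p ** q' - star q ** p').
Proof.
have [_ JJ Jl Jr sJ] := cstar_imaginary_unit A.
by rewrite (star_smul1i JJ Jl Jr sJ) addrACA -scalerBr.
Qed.

Lemma realpartE (p q : realform Phi) : realpart Phi (rfval p + 'i *: rfval q) = p.
Proof.
by rewrite realpartD realpart_i realpart_realform imagpart_realform oppr0 addr0.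
Qed.

Lemma imagpartE (p q : realform Phi) : imagpart Phi (rfval p + 'i *: rfval q) = q.
Proof.
by rewrite imagpartD imagpart_i realpart_realform imagpart_realform add0r.
Qed.

Lemma realpart_smul (x y : A) : realpart Phi (star x ** y) =
  star (realpart Phi x) ** realpart Phi y + star (imagpart Phi x) ** imagpart Phi y.
Proof.
rewrite {1}(realimagE Phi x) {1}(realimagE Phi y) realform_star_smul.
exact: realpartE.
Qed.

Lemma imagpart_smul (x y : A) : imagpart Phi (star x ** y) =
  star (realpart Phi x) ** imagpart Phi y - star (imagpart Phi x) ** realpart Phi y.
Proof.
rewrite {1}(realimagE Phi x) {1}(realimagE Phi y) realform_star_smul.
exact: imagpartE.
Qed.

Lemma cp_rfval : cp (fun a : realform Phi => rfval a).
Proof. by apply: cp_starhom. Qed.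

(** The target is left general to cover M_n(C), B and M(B). *)
Lemma cp_realform_complexification (T : starRngType) (J : T -> T)
    (f : realform Phi -> T) :
  imaginary_unit J -> {morph f : x y / x + y} -> cp f ->
  cp (fun x => f (realpart Phi x) + J (f (imagpart Phi x))).
Proof.
move=> [JD JJ Jl Jr sJ] fD.
exact: (cp_complexification JD JJ Jl Jr sJ (@realpartD _ _ _) (@imagpartD _ _ _)
  realpart_smul imagpart_smul fD).
Qed.

End RealForm.

Lemma cp_mx_complexification (R : realType) n (T : starRngType) (J : T -> T)
    (f : 'M[R^o]_n -> T) :
  imaginary_unit J -> {morph f : x y / x + y} -> cp f ->
  cp (fun Z => f (Remx Z) + J (f (Immx Z))).
Proof.
move=> [JD JJ Jl Jr sJ] fD.
exact: (cp_complexification JD JJ Jl Jr sJ (@RemxD _ _) (@ImmxD _ _)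
  (@Remx_smul _ _) (@Immx_smul _ _) fD).
Qed.

(** * Linear structure on the complexified and restricted factors *)

Section Factorizations.
Variables (R : realType) (A B : cstarAlgType R) (Phi : antiInvol A) (n : nat).

Section Complexify.
Variables (phi : {linear realform Phi -> 'M[R^o]_n}).
Variables (psi : {rlinear 'M[R^o]_n -> B}).

Definition Cmx_comp (a : realform Phi) : 'M[R[i]]_n := Cmx (phi a).

Lemma Cmx_comp_is_linear : linear_for (real_complex R \; *:%R) Cmx_comp.
Proof. by move=> r a b; rewrite /Cmx_comp linearD linearZ CmxD CmxZ. Qed.

HB.instance Definition _ := GRing.isLinear.Build R (realform Phi) 'M[R[i]]_n
  (real_complex R \; *:%R) Cmx_comp Cmx_comp_is_linear.

(** The counterpart of [complexify] for M_n(R) in M_n(C), which is not presented as a [realform]. *)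
Definition mx_complexify (Z : 'M[R[i]]_n) : B :=
  psi (Remx Z) + 'i *: psi (Immx Z).

Lemma mx_complexify_is_linear : linear mx_complexify.
Proof.
have fD a b : psi (a + b) = psi a + psi b by rewrite linearD.
have fN a : psi (- a) = - psi a by rewrite linearN.
have fZ (r : R) a : psi (r *: a) = r%:C *: psi a by rewrite linearZ_LR.
have cD x y : mx_complexify (x + y) = mx_complexify x + mx_complexify y.
  by rewrite /mx_complexify RemxD ImmxD !fD scalerDr addrACA.
have cZ (r : R) x : mx_complexify (r%:C *: x) = r%:C *: mx_complexify x.
  by rewrite /mx_complexify RemxZ ImmxZ !fZ scalerDr !scalerA mulrC.
have ci x : mx_complexify ('i *: x) = 'i *: mx_complexify x.
  by rewrite /mx_complexify Remx_i Immx_i fN scalerDr scale_iK addrC.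
(* Writing k = Re k + i Im k reduces complex homogeneity to real scalars and i. *)
by move=> k x y; rewrite cD [k]complexE !scalerDl cD -!scalerA ci !cZ.
Qed.

HB.instance Definition _ := GRing.isLinear.Build R[i] 'M[R[i]]_n B
  *:%R mx_complexify mx_complexify_is_linear.

End Complexify.

Section Realify.
Variables (phi : {linear A -> 'M[R[i]]_n}) (psi : {linear 'M[R[i]]_n -> B}).

Definition mx_realify_comp (a : realform Phi) : 'M[R^o]_(n + n) :=
  mx_realify (phi (rfval a)).

Lemma mx_realify_comp_is_linear : linear mx_realify_comp.
Proof.
move=> r a b; rewrite /mx_realify_comp /=.
by rewrite [phi _]linearP mx_realifyD mx_realifyZ.
Qed.

HB.instance Definition _ := GRing.isLinear.Build R (realform Phi)
  'M[R^o]_(n + n) *:%R mx_realify_comp mx_realify_comp_is_linear.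

Definition mx_unrealify_comp (W : 'M[R^o]_(n + n)) : B := psi (mx_unrealify W).

Lemma mx_unrealify_comp_is_linear :
  linear_for (real_complex R \; *:%R) mx_unrealify_comp.
Proof.
by move=> r a b; rewrite /mx_unrealify_comp mx_unrealifyD mx_unrealifyZ linearP.
Qed.

HB.instance Definition _ := GRing.isLinear.Build R 'M[R^o]_(n + n) B
  (real_complex R \; *:%R) mx_unrealify_comp mx_unrealify_comp_is_linear.

End Realify.
End Factorizations.

(** * Transfer of factorizations and point-norm limits *)

Section Nuclear.
Variables (R : realType) (A B : cstarAlgType R) (Phi : antiInvol A).

Lemma matrix_factored_complexify (f : realform Phi -> B) :
  matrix_factored_real f ->
  matrix_factored (fun x => f (realpart Phi x) + 'i *: f (imagpart Phi x)).
Proof.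
move=> [n [phi [psi [phi_cp psi_cp ->]]]].
exists n, (complexify (Cmx_comp phi)), (mx_complexify psi); split.
- apply: (cp_realform_complexification (mx_imaginary_unit R n)).
    exact: linearD.
  exact: (cp_comp (@cp_Cmx R n) phi_cp).
- apply: (cp_mx_complexification (cstar_imaginary_unit B)) => //.
  exact: linearD.
- apply/funext => x /=.
  (* The real and imaginary parts of the matrix phi^C(x) are the values of phi at the two parts of
     x, so psi^C after phi^C is the complexification of psi after phi. *)
  by rewrite /complexify /mx_complexify /Cmx_comp RemxE ImmxE.
Qed.

Lemma matrix_factored_restrict (f : A -> B) :
  matrix_factored f -> matrix_factored_real (fun a : realform Phi => f (rfval a)).
Proof.
move=> [n [phi [psi [phi_cp psi_cp ->]]]].
(* A detour through M_2n(R) is inserted between the factors; it cancels by [mx_realifyK]. *)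
exists (n + n)%N, (mx_realify_comp phi), (mx_unrealify_comp psi); split.
- exact: (cp_comp (@cp_mx_realify R n) (cp_comp phi_cp (cp_rfval (Phi := Phi)))).
- exact: (cp_comp psi_cp (@cp_mx_unrealify R n)).
- apply/funext => a /=.
  by rewrite /mx_unrealify_comp /mx_realify_comp mx_realifyK.
Qed.

(** The filter is pushed forward along [G]; the second hypothesis is point-norm continuity of [G] at
    [theta]. *)
Lemma point_norm_limit_map (X Y : Type) (P : set (X -> B)) (Q : set (Y -> B))
    (G : (X -> B) -> Y -> B) (theta : X -> B) :
  (forall f, P f -> Q (G f)) ->
  (forall F : set_system (X -> B), ProperFilter F ->
    (forall x, (fun f => f x) @ F --> theta x) ->
    forall y, (fun f => G f y) @ F --> G theta y) ->
  point_norm_limit P theta -> point_norm_limit Q (G theta).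
Proof.
move=> PQ G_cvg [F [F_filter FP F_cvg]]; exists (G @ F); split.
- exact: fmap_proper_filter.
- exact: (filterS (F := F) (P := P) (Q := G @^-1` Q) PQ FP).
- exact: G_cvg.
Qed.

(** Equal functions may be bundled with different linearity proofs, which [nuclear] does not see. *)
Lemma eq_nuclear (f g : {linear A -> B}) :
  f = g :> (A -> B) -> nuclear f <-> nuclear g.
Proof. by rewrite /nuclear => ->. Qed.

Lemma nuclear_complexify (theta : {rlinear realform Phi -> B}) :
  nuclear_real theta <-> nuclear (complexify theta).
Proof.
have restrictE :
    (fun a : realform Phi => complexify theta (rfval a)) = theta :> (_ -> _).
  apply/funext => a; rewrite /complexify realpart_realform imagpart_realform.
  by rewrite linear0 scaler0 addr0.
split=> -[theta_cp theta_lim]; split.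
- apply: (cp_realform_complexification (cstar_imaginary_unit B)) => //.
  exact: linearD.
- apply: (point_norm_limit_map (G := fun (f : realform Phi -> B) (x : A) =>
    f (realpart Phi x) + 'i *: f (imagpart Phi x)) _ _ theta_lim).
    exact: matrix_factored_complexify.
  move=> F F_filter F_cvg x.
  (* The value at x depends only on the values at its real and imaginary parts, so convergence at
     these two points is enough. *)
  by apply: cvgD; [exact: F_cvg|apply: cvgZl_tmp; exact: F_cvg].
- rewrite -[X in cp X]restrictE.
  exact: (cp_comp theta_cp (cp_rfval (Phi := Phi))).
- rewrite -[X in point_norm_limit _ X]restrictE.
  apply: (point_norm_limit_map
    (G := fun f (a : realform Phi) => f (rfval a)) _ _ theta_lim).
    exact: matrix_factored_restrict.
  by move=> F F_filter F_cvg a; exact: F_cvg.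
Qed.

End Nuclear.

(** * Weak nuclearity, one compression at a time *)

Theorem theorem2p4 (R : realType) (A B : cstarAlgType R) (Phi : antiInvol A)
    (phi : {rlinear realform Phi -> M(B)}) (hphi : cp phi) :
  weakly_nuclear_real phi <-> weakly_nuclear (complexify phi).
Proof.
have rcompressE b :
    complexify (rcompress b phi) = compress b \o complexify phi :> (A -> B).
  (* Compression by b is complex-linear on M(B), hence commutes with complexification. *)
  by apply/funext => x; rewrite /complexify /= linearD linearZ.
have nuclearE b : nuclear_real (rcompress b phi)
    <-> nuclear (compress b \o complexify phi).
  apply: (iff_trans (nuclear_complexify _)).
  exact: (@eq_nuclear R A B (complexify (rcompress b phi))
    (compress b \o complexify phi) (rcompressE b)).
split=> -[_ nuc]; split.
(* Complete positivity of phi^C itself, with i acting on M(B). *)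
- apply: (cp_realform_complexification (multiplier_imaginary_unit B)) hphi.
  exact: linearD.
- by move=> b; apply/nuclearE/nuc.
- exact: hphi.
- by move=> b; apply/nuclearE/nuc.
Qed.
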